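(* Let $a\ge 1$ and $b\ge 0$ be integers, let $G$ be a simple $(a,b)$-graph, and let $M$ be a matching of $G$. Then the graph $G_M$ is a $(2a-1,b)$-graph, i.e. every subgraph $H$ of $G_M$ satisfies $|E(H)|\le (2a-1)|V(H)|-b$.
   Context: For integers $a\ge1$, $b\ge0$, a graph $G$ is an $(a,b)$-graph if every subgraph $G'$ of $G$ (including $G$ itself) satisfies $|E(G')|\le a|V(G')|-b$. For a matching $M$ of $G$, $G_M$ denotes the graph obtained from $G$ by contracting every edge of $M$ (deleting the edge and identifying its end-vertices); $G_M$ may have multiple edges (counted with multiplicity) but no loops. *)

(* Defs.v *)
From mathcomp Require Import all_boot all_order all_algebra.

Set Implicit Arguments.
Unset Strict Implicit.
Unset Printing Implicit Defensive.

Import Order.TTheory GRing.Theory Num.Theory.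
Local Open Scope ring_scope.

(* A finite multigraph: parallel edges are distinct elements of [edge G] with
   the same set of ends; a loop is an edge with a single end. *)
Record mgraph := MGraph {
  vert : finType;
  edge : finType;
  ends : edge -> {set vert};
  ends_card : forall e, (0 < #|ends e| <= 2)%N
}.

Arguments ends {G} e : rename.

Definition simple_graph (G : mgraph) : Prop :=
  (forall e : edge G, #|ends e| = 2%N) /\ injective (@ends G).

Definition is_subgraph (G : mgraph) (W : {set vert G}) (F : {set edge G}) : Prop :=
  forall e, e \in F -> ends e \subset W.

(* Subgraphs have at least one vertex: for b > 0 the null graph would violate
   the bound, and no (a,b)-graph would exist. The bound is over [int], so that
   the subtraction is not truncated. *)
Definition ab_graph (a b : int) (G : mgraph) : Prop :=
  forall (W : {set vert G}) (F : {set edge G}),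
    W != set0 -> is_subgraph W F -> #|F|%:Z <= a * #|W|%:Z - b.

Definition matching (G : mgraph) (M : {set edge G}) : Prop :=
  forall e f, e \in M -> f \in M -> e != f -> [disjoint ends e & ends f].

Section Contraction.

Variables (G : mgraph) (M : {set edge G}).

Definition joined : rel (vert G) :=
  fun x y => [exists e in M, (x \in ends e) && (y \in ends e)].

Definition merged (x : vert G) : {set vert G} := [set y | connect joined x y].

(* A vertex of the contracted graph is a class of identified vertices of G. *)
Definition cvert : finType := {B : {set vert G} | B \in [set merged x | x : vert G]}.

Definition cproj (x : vert G) : cvert := exist _ (merged x) (imset_f merged (isT : x \in predT)).

Definition cedge : finType := {e : edge G | e \notin M}.

Definition cends (e : cedge) : {set cvert} := cproj @: ends (val e).

Fact cends_card e : (0 < #|cends e| <= 2)%N.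
Proof.
have /andP[e_gt0 e_le2] := ends_card (val e).
rewrite (leq_trans (leq_imset_card _ _) e_le2) andbT.
have /card_gt0P[x xe] := e_gt0.
by apply/card_gt0P; exists (cproj x); apply: imset_f.
Qed.

(* Parallel edges are kept. An edge outside M with both ends in one class would
   become a loop; this does not happen for a matching of a simple graph. *)
Definition contract : mgraph := MGraph cends_card.

End Contraction.

(* Main.v *)
(** Let [W] be the vertex set and [F] the edge set of a subgraph of [contract M],
    and let [m] be the number of edges of [M] that were contracted to a vertex
    of [W], so that [m <= #|W|]. Undoing these contractions gives a subgraph of
    [G] with at most [#|W| + m] vertices and exactly [#|F| + m] edges. Hence
    [#|F| + m <= a * (#|W| + m) - b], and
    [#|F| <= a * #|W| + (a - 1) * m - b <= (2 * a - 1) * #|W| - b]. *)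
Require Import Defs.
From mathcomp Require Import all_boot all_order all_algebra.
From mathcomp Require Import zify.

Set Implicit Arguments.
Unset Strict Implicit.
Unset Printing Implicit Defensive.

Import Order.TTheory GRing.Theory Num.Theory.
Local Open Scope ring_scope.

Lemma matching_eq (G : mgraph) (M : {set edge G}) (e f : edge G) (x : vert G) :
  matching M -> e \in M -> f \in M -> x \in ends e -> x \in ends f -> e = f.
Proof.
move=> hM eM fM xe xf; apply/eqP/negPn/negP => nef.
by have /pred0P/(_ x) := hM e f eM fM nef; rewrite /= xe xf.
Qed.

Lemma matching_ends_inj (G : mgraph) (M : {set edge G}) :
  matching M -> {in M &, injective (@ends G)}.
Proof.
move=> hM e f eM fM eqef.
have /andP[/card_gt0P[x xe] _] := ends_card e.
by apply: (matching_eq hM eM fM xe); rewrite -eqef.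
Qed.

Lemma merged_refl (G : mgraph) (M : {set edge G}) (x : vert G) : x \in merged M x.
Proof. by rewrite inE connect0. Qed.

(** A path of [joined] starting in [ends e] never leaves it: by disjointness, an edge of [M] used at
    a vertex of [ends e] must be [e] itself. *)
Lemma merged_matched (G : mgraph) (M : {set edge G}) (e : edge G) (x : vert G) :
  matching M -> e \in M -> x \in ends e -> merged M x = ends e.
Proof.
move=> hM eM xe; apply/setP => y; rewrite inE; apply/idP/idP => [|ye]; last first.
  by apply/connect1/existsP; exists e; rewrite eM xe ye.
case/connectP=> p; elim: p x xe => [|z p IHp] x xe /=; first by move=> _ ->.
case/andP=> /existsP[f /and3P[fM xf zf]] zp; apply: IHp zp.
by rewrite (matching_eq hM eM fM xe xf).
Qed.

Lemma merged_unmatched (G : mgraph) (M : {set edge G}) (x : vert G) :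
  (forall e, e \in M -> x \notin ends e) -> merged M x = [set x].
Proof.
move=> xM; apply/setP => y; rewrite !inE; apply/idP/eqP => [|->]; last exact: connect0.
case/connectP=> [[|z p]] //= /andP[/existsP[e /and3P[eM xe _]] _].
by rewrite (negPf (xM e eM)) in xe.
Qed.

(** The boolean counts as 0 or 1, so that summing over [W] yields [#|W|] plus the number of classes
    that come from an edge of [M]. *)
Lemma card_cvert_le (G : mgraph) (M : {set edge G}) (B : cvert M) :
  matching M -> (#|val B| <= 1 + (val B \in [set ends e | e in M]))%N.
Proof.
move=> hM; have /imsetP[x _ ->] := valP B.
case: (pickP [pred e in M | x \in ends e]) => [e /andP[eM xe]|none].
  rewrite (merged_matched hM eM xe) imset_f //.
  by have /andP[] := ends_card e.
rewrite merged_unmatched ?cards1 // => e eM.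
by have /negbT := none e; rewrite /= eM.
Qed.

Theorem theorem7 (a b : int) (ha : 1 <= a) (hb : 0 <= b)
    (G : mgraph) (hG : simple_graph G) (hab : ab_graph a b G)
    (M : {set edge G}) (hM : matching M) :
  ab_graph (2 * a - 1) b (contract M).
Proof.
move=> /= W F /set0Pn[B0 B0W] subF.
pose V := [set val B | B in W].
(* By [merged_matched], [e] is contracted to the class [ends e], so [ends e \in V] says that this
   class is a vertex of [W]. *)
pose M' := [set e in M | ends e \in V].
pose W1 := \bigcup_(B in W) val B.
pose F1 := [set val e | e in F].
have cardV : #|V| = #|W| by rewrite card_imset //; exact: val_inj.
have cardF1 : #|F1| = #|F| by rewrite card_imset //; exact: val_inj.
have M'M : {subset M' <= M} by move=> e; rewrite inE => /andP[].
have cardM' : #|[set ends e | e in M']| = #|M'|.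
  by apply: card_in_imset => e f /M'M eM /M'M fM; exact: (matching_ends_inj hM).
have leM' : (#|M'| <= #|W|)%N.
  rewrite -cardM' -cardV; apply/subset_leq_card/subsetP => _ /imsetP[e eM' ->].
  by move: eM'; rewrite inE => /andP[].
have leW1 : (#|W1| <= #|W| + #|M'|)%N.
  have leU : (#|W1| <= \sum_(B in W) #|val B|)%N.
    rewrite /W1; elim/big_rec2: _ => [|B n A _ leA]; first by rewrite cards0.
    by rewrite (leq_trans (leq_card_setU _ _).1) ?leq_add2l.
  apply: leq_trans leU _.
  apply: leq_trans (leq_sum _ (fun B _ => card_cvert_le B hM)) _.
  (* The booleans add up to the number of [B] in [W] that are end sets of edges of [M]; [val] embeds
     these into the end sets of [M']. *)
  rewrite big_split /= sum1_card leq_add2l -big_mkcondr /= sum1_card -cardM'.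
  rewrite -(card_imset _ val_inj); apply/subset_leq_card/subsetP => _ /imsetP[B + ->].
  rewrite unfold_in => /andP[BW /imsetP[e eM eB]]; apply/imsetP; exists e => //.
  by rewrite inE eM -eB imset_f.
have W1n0 : W1 != set0.
  have /imsetP[x _ B0x] := valP B0.
  by apply/set0Pn; exists x; apply/bigcupP; exists B0; rewrite ?B0x ?merged_refl.
have sub1 : is_subgraph W1 (F1 :|: M').
  move=> e /setUP[/imsetP[f fF ->]|].
    (* The class of an end of [f] in [G] is an end of [f] in the contraction, hence lies in [W]. *)
    apply/subsetP => x xf; apply/bigcupP; exists (cproj M x); last exact: merged_refl.
    by apply: (subsetP (subF f fF)); apply: imset_f.
  by rewrite inE => /andP[_ /imsetP[B BW ->]]; exact: (bigcup_sup B).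
have cardU : #|F1 :|: M'| = (#|F| + #|M'|)%N.
  rewrite cardsU cardF1 (_ : F1 :&: M' = set0) ?cards0 ?subn0 //.
  (* Edges of the contraction lie outside [M] by the type [cedge]. *)
  apply/setP => e; rewrite in_set0; apply/negP => /setIP[/imsetP[f _ ->] /M'M].
  by rewrite (negPf (valP f)).
have := hab _ _ W1n0 sub1; rewrite cardU => bound.
change (#|F|%:Z <= (2 * a - 1) * #|W|%:Z - b).
move: leM' leW1 bound ha.
move: #|F| #|W| #|M'| #|W1| => f w m w1 leM' leW1 bound a_ge1.
(* Products with [a] are atoms for [lia], so the vertex bound is scaled by [a] and [m <= w] by
   [a - 1], both nonnegative since [1 <= a]. *)
have bound1 : a * w1%:Z <= a * (w%:Z + m%:Z) by apply: ler_wpM2l; lia.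
have bound2 : (a - 1) * m%:Z <= (a - 1) * w%:Z by apply: ler_wpM2l; lia.
lia.
Qed.
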